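(* Let $\mu$ be a probability measure on $\mathbb{R}^d\times\mathbb{R}^d$ with a positive $C^1$ density (still denoted by $\mu$), and let $$\mu^{X|Y=y}(x):=\frac{\mu(x,y)\,\mathrm{d}x}{\int_{\mathbb{R}^d}\mu(x',y)\,\mathrm{d}x'}$$ be the conditional law on $\mathbb{R}^d$ (identified with its density in $x$). Then $\kappa_{-\log\mu^{X|Y=y}}(r)\ge\kappa_{-\log\mu}(r)$ for every $r>0$, for a.e. $y\in\mathbb{R}^d$.
   Context: For a $C^1$ function $\varphi:\mathbb{R}^n\to\mathbb{R}$ the weak semiconvexity profile is $\kappa_\varphi(r):=r^{-2}\inf_{|x-\hat x|=r}\langle\nabla\varphi(x)-\nabla\varphi(\hat x),x-\hat x\rangle$ for $r>0$ (here $n=2d$ for $-\log\mu$ and $n=d$ for $-\log\mu^{X|Y=y}$). *)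

(* Defs.v *)
From HB Require Import structures.
From mathcomp Require Import all_boot all_order all_algebra.
From mathcomp Require Import all_classical all_reals all_analysis.
Set Implicit Arguments.
Unset Strict Implicit.
Unset Printing Implicit Defensive.
Import Order.TTheory GRing.Theory Num.Theory.
Import numFieldNormedType.Exports.
Local Open Scope classical_set_scope.
Local Open Scope ring_scope.

(* R^n plays two roles: as a normed space it is ['rV[R]_n]; as a measurable
   space it is the type of n-tuples with the product of the Borel
   sigma-algebras. [vec] is the identification between the two. *)
Notation tupR R n := (n.-tuple (measurableTypeR R)).

Definition vec (R : realType) (n : nat) (t : tupR R n) : 'rV[R]_n :=
  \row_(i < n) tnth t i.

Section lebesgue_step.
Context (R : realType) (n : nat).
Variable m : {sigma_finite_measure set (tupR R n) -> \bar R}.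

Definition tcons (z : measurableTypeR R * tupR R n) : tupR R n.+1 :=
  [the n.+1.-tuple (measurableTypeR R) of z.1 :: z.2].

Lemma measurable_tcons : measurable_fun [set: _] tcons.
Proof. exact: (measurable_cons measurable_fst measurable_snd). Qed.

Definition lebesgue_step : set (tupR R n.+1) -> \bar R :=
  pushforward (lebesgue_measure \x m)%E tcons.

HB.instance Definition _ := Measure.copy lebesgue_step
  (measure_function_pushforward__canonical__measure_function_Measure
     (lebesgue_measure \x m)%E measurable_tcons).

Let uncons (t : tupR R n.+1) : measurableTypeR R * tupR R n :=
  (thead t, [tuple of behead t]).

Let tconsK : cancel tcons uncons.
Proof.
move=> [x t]; rewrite /uncons/= theadE; congr pair; exact: val_inj.
Qed.

Let measurable_uncons : measurable_fun [set: _] uncons.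
Proof.
apply/measurable_fun_pairP; split => /=; first exact: measurable_tnth.
exact: measurable_behead.
Qed.

Let lebesgue_step_sigma_finite : sigma_finite setT lebesgue_step.
Proof.
have /sigma_finiteP[F [TF ndF Foo]] :=
  sigma_finiteT (@lebesgue_measure R : {sigma_finite_measure set _ -> \bar R}).
have /sigma_finiteP[G [TG ndG Goo]] := sigma_finiteT m.
exists (fun k => uncons @^-1` (F k `*` G k)).
  apply/seteqP; split => // t _.
  have [i _ Fi] : (\bigcup_k F k) (thead t) by rewrite -TF.
  have [j _ Gj] : (\bigcup_k G k) [tuple of behead t] by rewrite -TG.
  exists (maxn i j) => //; split => /=.
    by move: Fi; exact/subsetPset/ndF/leq_maxl.
  by move: Gj; exact/subsetPset/ndG/leq_maxr.
move=> k; have [mFk Fk] := Foo k; have [mGk Gk] := Goo k; split.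
  rewrite -[X in measurable X]setTI; apply: measurable_uncons => //.
  exact: measurableX.
rewrite /lebesgue_step /pushforward -comp_preimage.
rewrite (_ : uncons \o tcons = id) ?preimage_id; last first.
  by apply/funext => z /=; rewrite tconsK.
by rewrite product_measure1E// lte_mul_pinfty// ge0_fin_numE.
Qed.

HB.instance Definition _ := Measure_isSigmaFinite.Build _ _ _
  lebesgue_step lebesgue_step_sigma_finite.

End lebesgue_step.

Fixpoint leb (R : realType) (n : nat) :
    {sigma_finite_measure set (tupR R n) -> \bar R} :=
  if n is n'.+1 then lebesgue_step (leb R n')
  else \d_[tuple].

(* This characterizes [leb R n] as the Lebesgue measure on R^n. *)
Lemma leb_box (R : realType) (n : nat) (A : 'I_n -> set (measurableTypeR R)) :
  (forall i, measurable (A i)) ->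
  leb R n [set t | forall i, A i (tnth t i)] =
  (\prod_(i < n) lebesgue_measure (A i))%E.
Proof.
elim: n A => [|n IH] A mA.
  rewrite big_ord0 /= diracE mem_set//= => -[] //.
rewrite big_ord_recl -IH; last by move=> i; exact: mA.
rewrite /= /lebesgue_step /pushforward -product_measure1E //; last first.
  rewrite (_ : mkset _ = \big[setI/setT]_(i < n)
    ((@tnth n (measurableTypeR R))^~ i @^-1` A (lift ord0 i))).
    apply: big_ind => //; first by move=> *; exact: measurableI.
    move=> i _; rewrite -[X in measurable X]setTI; exact: measurable_tnth.
  apply/seteqP; split => t /=.
    by move=> h; elim/big_ind : _ => // X Y.
  by rewrite -bigcap_seq => h i; apply: (h i); rewrite /= mem_index_enum.
congr ((_ \x _)%E _); apply/seteqP; split => -[x t] /=.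
  move=> h; split; first exact: (h ord0).
  by move=> i; have := h (lift ord0 i); rewrite tnthS.
move=> [hx ht] i; case: (unliftP ord0 i) => [j ->|->//].
by rewrite tnthS; exact: ht.
Qed.

Section profile.
Context (R : realType) (n : nat).
Implicit Types (phi : 'rV[R]_n -> R) (u v x : 'rV[R]_n).

Definition dot u v : R := \sum_(i < n) u 0 i * v 0 i.

(* The norm [`|_|] of ['rV[R]_n] is the sup norm. *)
Definition enorm u : R := Num.sqrt (dot u u).

Definition grad phi x : 'rV[R]_n := \row_(i < n) 'D_(delta_mx 0 i) phi x.

Definition C1 phi : Prop :=
  (forall x, differentiable phi x) /\ continuous (grad phi).

Definition kappa phi (r : R) : \bar R :=
  ((r ^- 2)%:E *
   ereal_inf [set (dot (grad phi z.1 - grad phi z.2) (z.1 - z.2))%:E |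
               z in [set z : 'rV[R]_n * 'rV[R]_n | enorm (z.1 - z.2) = r]])%E.

End profile.

(* [has_density mu p]: the law [mu] on R^d x R^d has density [p] with respect
   to Lebesgue measure, where (x, y) is identified with [row_mx x y] in
   R^(d + d). *)
Definition has_density (R : realType) (d : nat)
    (mu : probability (tupR R d * tupR R d)%type R)
    (p : 'rV[R]_(d + d) -> R) : Prop :=
  forall A, measurable A ->
    mu A = (\int[(leb R d \x leb R d)%E]_(z in A)
              (p (row_mx (vec z.1) (vec z.2)))%:E)%E.

(* The denominator is the junk value 0 when the integral of the y-section of
   [p] diverges; for an integrable [p] this only occurs on a null set of y. *)
Definition cond_density (R : realType) (d : nat) (p : 'rV[R]_(d + d) -> R)
    (y x : 'rV[R]_d) : R :=
  p (row_mx x y) / \int[leb R d]_x' p (row_mx (vec x') y).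

(* Main.v *)
(* For almost every y the normalization Z = int p(x', y) dx' is finite (Tonelli)
   and positive. Then - ln p(x|y) = - ln p(x, y) + ln Z, so its gradient is the
   x-part of the gradient of - ln p at (x, y), and the infimum defining the
   profile of the conditional law is the restriction of the one for p to pairs
   of points with the same y. *)
Require Import Defs.
From HB Require Import structures.
From mathcomp Require Import all_boot all_order all_algebra.
From mathcomp Require Import all_classical all_reals all_analysis.
From mathcomp Require Import measurable_realfun.
Set Implicit Arguments.
Unset Strict Implicit.
Unset Printing Implicit Defensive.
Import Order.TTheory GRing.Theory Num.Theory.
Import numFieldNormedType.Exports.
Local Open Scope classical_set_scope.
Local Open Scope ring_scope.

(* An open subset of R^n is the union of the balls of rational center and
   radius that it contains. *)
Lemma open_preimage_measurable d (T : measurableType d) (R : realType) n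
    (g : T -> 'rV[R]_n) (O : set 'rV[R]_n) :
  (forall i, measurable_fun setT (fun t => g t 0 i : measurableTypeR R)) ->
  open O -> measurable (g @^-1` O).
Proof.
move=> mg oO.
pose ctr (c : 'rV[rat]_n * rat) : 'rV[R]_n := map_mx ratr c.1.
pose B c := [set t | 0 < ratr c.2 :> R /\ ball (ctr c) (ratr c.2) `<=` O
  /\ ball (ctr c) (ratr c.2) (g t)].
have -> : g @^-1` O = \bigcup_c B c.
  apply/seteqP; split => [t Ogt|t [c _ [c0 [cO /cO]]]//].
  have /nbhs_ballP[e /= e0 eO] := open_nbhs_nbhs (conj oO Ogt).
  (* With [q < e / 2] and a center closer than [q] to [g t], the triangle inequality keeps the
     rational ball inside the [e]-ball around [g t]. *)
  have /rat_in_itvoo[q /itvP qe] : 0 < e / 2 by rewrite divr_gt0.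
  have q0 : 0 < ratr q :> R by rewrite qe.
  have cen i : {r : rat | `|ratr r - g t 0 i| < ratr q}.
    apply: cid; have /rat_in_itvoo[r /itvP rg] :
      g t 0 i < g t 0 i + ratr q by rewrite ltrDl.
    by exists r; rewrite ger0_norm ?subr_ge0 ?ltrBlDl ?rg.
  exists (\row_i sval (cen i), q) => //; split => //.
  have gb : ball (ctr (\row_i sval (cen i), q)) (ratr q) (g t).
    split => //= i j; rewrite !mxE ord1.
    by rewrite /ball/=; case: (cen j).
  split => // y yb; apply: eO.
  apply: (@le_ball _ _ _ (ratr q + ratr q)).
    by rewrite [leRHS]splitr lerD// ltW// qe.
  by apply: ball_triangle yb; exact: ball_sym.
apply: countable_bigcupT_measurable => // c.
have [c0|c0] := pselect (0 < ratr c.2 :> R /\ ball (ctr c) (ratr c.2) `<=` O);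
  last by rewrite (_ : B c = set0)//; apply/seteqP; split => // t [? []] *;
    case: c0.
(* Balls of the sup norm are boxes, so membership is a finite conjunction of conditions on single
   coordinates. *)
rewrite (_ : B c = \bigcap_(i in [set: 'I_n])
    ((fun t => g t 0 i : measurableTypeR R) @^-1` ball (ctr c 0 i) (ratr c.2))).
  apply: fin_bigcap_measurable => // i _; rewrite -[X in measurable X]setTI.
  apply: mg => //; exact: measurable_ball.
apply/seteqP; split => [t [_ [_ [_ h]]] i _|t h]; first exact: h.
by case: c0 => ? ?; do 3 split => //; move=> i j; rewrite ord1; exact: h.
Qed.

Lemma continuous_row_measurable d (T : measurableType d) (R : realType) n
    (g : T -> 'rV[R]_n) (f : 'rV[R]_n -> R) :
  (forall i, measurable_fun setT (fun t => g t 0 i : measurableTypeR R)) ->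
  continuous f ->
  measurable_fun setT (fun t => f (g t) : measurableTypeR R).
Proof.
move=> mg /continuousP cf; apply: (measurability _ (RGenOpens.measurableE R)).
move=> _ [_ [a [b ->] <-]]; rewrite setTI.
exact: (open_preimage_measurable mg (cf _ (interval_open _ _))).
Qed.

(** Links the topology of row vectors, where [p] is continuous, to the product sigma-algebra on
    tuples, over which [has_density] integrates. *)
Lemma measurable_row_mx_vec (R : realType) n m (p : 'rV[R]_(n + m) -> R) :
  continuous p ->
  measurable_fun setT (fun z : tupR R n * tupR R m =>
    p (row_mx (vec z.1) (vec z.2)) : measurableTypeR R).
Proof.
apply: continuous_row_measurable => i.
case: (split_ordP i) => j ->.
- rewrite (_ : (fun _ => _) =
      (fun t : tupR R n => tnth t j : measurableTypeR R) \o fst).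
    exact: measurableT_comp (measurable_tnth _) measurable_fst.
  by apply/funext => z; rewrite row_mxEl mxE.
- rewrite (_ : (fun _ => _) =
      (fun t : tupR R m => tnth t j : measurableTypeR R) \o snd).
    exact: measurableT_comp (measurable_tnth _) measurable_snd.
  by apply/funext => z; rewrite row_mxEr mxE.
Qed.

(** The whole space is a box, so its measure is a product of nonzero factors; for [n = 0] the empty
    product is 1. *)
Lemma leb_setT_neq0 (R : realType) n : leb R n setT != 0%E.
Proof.
have /= := @leb_box R n (fun=> setT) (fun=> measurableT).
rewrite (_ : [set t | _] = setT); last by apply/seteqP; split.
move=> ->; elim/big_ind : _ => //.
- by move=> x y; rewrite mule_eq0 negb_or => -> ->.
- by move=> i _; rewrite -set_itvNyy lebesgue_measure_itv.
Qed.

Lemma integral_gt0_of_pos d (T : measurableType d) (R : realType)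
    (m : {measure set T -> \bar R}) (f : T -> R) :
  m setT != 0%E -> measurable_fun setT f -> (forall x, 0 < f x) ->
  (0 < \int[m]_x (f x)%:E)%E.
Proof.
move=> m0 mf f0; rewrite lt0e integral_ge0 ?andbT; last first.
  by move=> x _; rewrite lee_fin ltW.
apply: contra m0 => /eqP if0.
have : ae_eq m setT (EFin \o f) (cst 0%E).
  apply/ae_eq_integral_abs => //; first exact/measurable_EFinP.
  by under eq_integral do rewrite /= gtr0_norm//.
(* The null set [A] contains every point where [f] is nonzero, hence the whole space. *)
move=> [A [mA A0 sA]]; rewrite -measure_le0 -A0 le_measure ?inE// => x _.
by apply: sA => /= /(_ I) [] h; have := f0 x; rewrite h ltxx.
Qed.

Lemma cond_mass_pos (R : realType) (d : nat)
    (mu : probability (tupR R d * tupR R d)%type R)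
    (p : 'rV[R]_(d + d) -> R) :
  (forall z, 0 < p z) -> continuous p -> has_density mu p ->
  {ae leb R d, forall y : tupR R d,
    0 < \int[leb R d]_x' p (row_mx (vec x') (vec y))}.
Proof.
move=> p0 cp mup; have mp := measurable_row_mx_vec cp.
have ip : (leb R d \x leb R d)%E.-integrable setT
    (fun z => (p (row_mx (vec z.1) (vec z.2)))%:E).
  apply/integrableP; split; first exact/measurable_EFinP.
  under eq_integral do rewrite /= gtr0_norm//.
  by rewrite -mup// probability_setT ltry.
have := ae_integrable2 ip; apply: filterS => y /= iy.
(* The real integral is [fine] of the extended one, which sends [+oo] to 0: positivity needs the
   extended integral to be both positive and finite. Finiteness comes from the integrability of
   almost every section. *)
apply: fine_gt0; apply/andP; split.
  apply: integral_gt0_of_pos => //; first exact: leb_setT_neq0.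
  by have /measurable_int/measurable_EFinP := iy.
by have /fin_numPlt/andP[] := integrable_fin_num measurableT iy.
Qed.

(** The difference quotients already coincide before the limit: [c] cancels, and moving [x] along a
    basis vector moves [row_mx x y] along the left-shifted one. *)
Lemma grad_row_mxl (R : realType) n m (phi : 'rV[R]_(n + m) -> R)
    (psi : 'rV[R]_n -> R) (y : 'rV[R]_m) (c : R) :
  (forall x, psi x = phi (row_mx x y) + c) ->
  forall x, grad psi x = lsubmx (grad phi (row_mx x y)).
Proof.
move=> psiE x; apply/rowP => i; rewrite !mxE /derive.
suff -> : (fun h : R => h^-1 *:
    ((psi \o shift x) (h *: (delta_mx 0 i : 'rV[R]_n)) - psi x)) =
  (fun h : R => h^-1 *: ((phi \o shift (row_mx x y))
    (h *: (delta_mx 0 (lshift m i) : 'rV[R]_(n + m))) - phi (row_mx x y))) by [].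
apply/funext => h /=; rewrite !psiE opprD addrACA subrr addr0.
congr (_ *: (phi _ - _)); apply/rowP => j; case: (split_ordP j) => k ->.
  by rewrite row_mxEl ![LHS]mxE ![RHS]mxE row_mxEl !mxE eq_lshift.
by rewrite row_mxEr ![RHS]mxE row_mxEr !mxE eq_rlshift andbF mulr0 add0r.
Qed.

Lemma dot_row_mx (R : realType) n m (u : 'rV[R]_(n + m)) (v : 'rV[R]_n) :
  dot u (row_mx v 0) = dot (lsubmx u) v.
Proof.
rewrite /dot big_split_ord/= [X in _ + X]big1 ?addr0.
  by apply: eq_bigr => i _; rewrite row_mxEl mxE.
by move=> i _; rewrite row_mxEr mxE mulr0.
Qed.

Lemma kappa_row_mxl (R : realType) n m (phi : 'rV[R]_(n + m) -> R)
    (psi : 'rV[R]_n -> R) (y : 'rV[R]_m) (c r : R) :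
  (forall x, psi x = phi (row_mx x y) + c) ->
  (kappa phi r <= kappa psi r)%E.
Proof.
move=> psiE; apply: lee_wpmul2l.
  by rewrite lee_fin invr_ge0 exprn_even_ge0.
apply: ereal_inf_le_tmp => _ [[x x'] /= xx' <-].
(* The second block of the difference vanishes, so the Euclidean norm and the inner product see only
   the first block. *)
have sub : row_mx x y - row_mx x' y = row_mx (x - x') 0.
  by rewrite opp_row_mx add_row_mx subrr.
exists (row_mx x y, row_mx x' y) => /=.
  by rewrite sub /enorm dot_row_mx row_mxKl.
by rewrite sub dot_row_mx !(grad_row_mxl psiE) linearB.
Qed.

Theorem lemma1p5 (R : realType) (d : nat)
    (mu : probability (tupR R d * tupR R d)%type R)
    (p : 'rV[R]_(d + d) -> R)
    (p_gt0 : forall z, 0 < p z)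
    (p_C1 : C1 p)
    (mu_p : has_density mu p) :
  {ae leb R d, forall y : tupR R d, forall r : R, 0 < r ->
    (kappa (fun z => (- ln (p z))%R) r
       <= kappa (fun x => (- ln (cond_density p (vec y) x))%R) r)%E}.
Proof.
have cp : continuous p by move=> z; exact/differentiable_continuous/p_C1.1.
have := cond_mass_pos p_gt0 cp mu_p; apply: filterS => y Z0 r _.
(* The additive constant is the logarithm of the normalization; [Z0] is what lets [ln_div] split the
   logarithm of the quotient. *)
apply: (@kappa_row_mxl _ _ _ _ _ (vec y)
  (ln (\int[leb R d]_x' p (row_mx (vec x') (vec y))))) => x.
by rewrite /cond_density ln_div ?posrE// opprB addrC.
Qed.
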